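(* For every odd $m$ with $3\le m\leq 17$, and for every odd $m\ge3$ satisfying the cyclic interval property, namely that for every subset $x\subseteq\mathbb{Z}_m$ with $x\notin\{\emptyset,\mathbb{Z}_m\}$ there exists an arc $W\subseteq\mathbb{Z}_m$ with $|W\triangle x|<\min(|W|,\,m-|W|)$, one has $$k_{\min}(C_m)=m-1 .$$
   Context: $C_m$ is the cycle graph on $m$ vertices. An arc in $\mathbb{Z}_m$ is a cyclic interval, i.e. a set of consecutive residues; $\triangle$ is symmetric difference. For a generating set $S\subseteq\mathbb{Z}_2^k\setminus\{0\}$, $\mathrm{Cay}(\mathbb{Z}_2^k,S)$ is the graph on $\mathbb{Z}_2^k$ with edges $\{g,g+s\}$, $s\in S$. $k_{\min}(G)$ is the least $k$ such that the finite connected graph $G$ embeds isometrically (preserving shortest-path distances) into $\mathrm{Cay}(\mathbb{Z}_2^k,S)$ for some such $S$. *)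

(* Defs.v *)
From HB Require Import structures.
From mathcomp Require Import all_boot all_algebra all_fingroup.

Set Implicit Arguments.
Unset Strict Implicit.
Unset Printing Implicit Defensive.

(* A graph on a finType T is given by its (symmetric) adjacency relation. *)

(* The least n < #|T| such that some walk with n edges joins x to y.  The
   length of a shortest path is always < #|T|, so this is the shortest-path
   distance whenever y is reachable from x; otherwise the value is #|T|. *)
Definition dist (T : finType) (e : rel T) (x y : T) : nat :=
  find (fun n => [exists p : n.-tuple T, path e x p && (last x p == y)])
       (iota 0 #|T|).

(* 'Z_m has m elements only for m > 1, and this is the m-cycle only for m >= 3. *)
Definition cycle_graph (m : nat) : rel 'Z_m :=
  fun i j => (j == i + 1)%R || (i == j + 1)%R.
Arguments cycle_graph : clear implicits.

Definition Cay (k : nat) (S : {set 'rV['F_2]_k}) : rel 'rV['F_2]_k :=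
  fun g h => [exists s in S, h == g + s]%R.

(* The group law of 'rV['F_2]_k is addition, so <<S>> is the additive subgroup
   generated by S. *)
Definition embeds_in_Cay (T : finType) (e : rel T) (k : nat) : Prop :=
  exists S : {set 'rV['F_2]_k},
    [/\ 0%R \notin S, <<S>>%g = [set: 'rV['F_2]_k]
      & exists f : T -> 'rV['F_2]_k,
          forall x y : T, dist (Cay S) (f x) (f y) = dist e x y].

Definition is_kmin (T : finType) (e : rel T) (k : nat) : Prop :=
  embeds_in_Cay e k /\ (forall j : nat, embeds_in_Cay e j -> k <= j).

Definition is_arc (m : nat) (W : {set 'Z_m}) : Prop :=
  exists (a : 'Z_m) (l : nat), W = [set (a + i%:R)%R | i : 'I_l].

Definition symdiff (T : finType) (A B : {set T}) : {set T} :=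
  (A :\: B) :|: (B :\: A).

Definition cyclic_interval_property (m : nat) : Prop :=
  forall x : {set 'Z_m}, x != set0 -> x != [set: 'Z_m] ->
    exists2 W : {set 'Z_m},
      is_arc W & #|symdiff W x| < minn #|W| (m - #|W|).

(* Main.v *)
Require Import Defs.
From mathcomp Require Import all_boot all_algebra all_fingroup.
From mathcomp Require Import zify.

Set Implicit Arguments.
Unset Strict Implicit.
Unset Printing Implicit Defensive.

Import GRing.Theory.

(* Lower bound: an isometric embedding f of the m-cycle labels the edge from i
   to i+1 by s_i = f(i) + f(i+1), an element of S.  If x is a nonempty set of
   edges of even size 2h with zero label sum, choose p, q in x so that both
   closed arcs W with ends p and q contain h+1 elements of x.  The labels of W
   and of the symmetric difference of W and x have the same sum, so the ends of
   the path W are at distance at most |W| - 2 in the Cayley graph.  With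
   d = q - p, the two arcs give m <= 2d and 2d <= m, impossible for m odd.
   Hence a set of edges is determined by its label sum and its parity, so
   2^m <= 2 * 2^k.
   Upper bound: in the folded cube, whose distance is min(|v|, m - |v|), the
   prefix vectors 1^i 0^(m-1-i) form an isometric m-cycle. *)

(** * Shortest-path distance from walks and potentials *)

Section Distance.
Variables (T : finType) (e : rel T).

Lemma dist_le_path (x : T) (p : seq T) :
  path e x p -> dist e x (last x p) <= size p.
Proof.
move=> xp; rewrite /dist.
(* A walk with at least [#|T|] edges is too long for the search list, but [find] never exceeds the
   length [#|T|] of that list. *)
have [ltpT|leTp] := ltnP (size p) #|T|; last first.
  by apply: leq_trans leTp; rewrite -[X in _ <= X](size_iota 0); apply: find_size.
rewrite leqNgt; apply/negP => /(before_find 0); rewrite nth_iota // add0n.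
move=> /negbT/existsP; apply; exists (in_tuple p).
by rewrite /= xp eqxx.
Qed.

(** The hypothesis [d <= #|T|] covers the default value [#|T|], taken when the search finds no
    walk. *)
Lemma leq_dist (x y : T) (d : nat) :
  d <= #|T| -> (forall p, path e x p -> last x p = y -> d <= size p) ->
  d <= dist e x y.
Proof.
move=> dT dmin; rewrite /dist; set P := (X in find X _).
have [hasP|] := boolP (has P (iota 0 #|T|)); last first.
  by move=> /hasNfind->; rewrite size_iota.
have := nth_find 0 hasP; rewrite nth_iota; last first.
  by rewrite -[X in _ < X](size_iota 0) -has_find.
rewrite add0n => /existsP[p /andP[xp /eqP lastp]].
by rewrite -[X in _ <= X](size_tuple p); apply: dmin.
Qed.

Lemma dist_refl (x : T) : dist e x x = 0.
Proof. by apply/eqP; rewrite -leqn0 (dist_le_path (p := [::])). Qed.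

Lemma dist1_edge (x y : T) : dist e x y = 1 -> e x y.
Proof.
move=> d1; have nxy : x != y by apply: contra_eq_neq d1 => ->; rewrite dist_refl.
have T2 : 2 <= #|T|.
  by rewrite -[X in X <= _](_ : #|[set x; y]| = 2) ?max_card // cards2 nxy.
apply/negPn/negP => nexy; suff: 2 <= dist e x y by rewrite d1.
apply: leq_dist => // -[|z [|z' p]] //= => [_ xy|].
  by rewrite xy eqxx in nxy.
by rewrite andbT => xz zy; rewrite -zy xz in nexy.
Qed.

Lemma path_lipschitz (g : T -> nat) (x : T) (p : seq T) :
  (forall y z, e y z -> g z <= (g y).+1) -> path e x p ->
  g (last x p) <= g x + size p.
Proof.
move=> lip; elim: p x => [|z p IHp] x /=; first by rewrite addn0.
move=> /andP[/lip gz /IHp]; lia.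
Qed.

(** A potential that grows by at most one per edge bounds every walk from below; a single walk
    attaining it then fixes the distance. Both the cycle and the folded cube are measured this
    way. *)
Lemma dist_eq (g : T -> nat) (x : T) (p : seq T) :
    (forall y z, e y z -> g z <= (g y).+1) -> g x = 0 ->
    path e x p -> size p = g (last x p) -> g (last x p) <= #|T| ->
  dist e x (last x p) = g (last x p).
Proof.
move=> lip gx0 xp szp gT; apply/eqP; rewrite eqn_leq.
rewrite -[X in _ <= X]szp dist_le_path //=.
apply: leq_dist => // q xq <-.
by have := path_lipschitz lip xq; rewrite gx0.
Qed.

End Distance.

(** * Distances in the cycle *)

Section Cycle.
Variable n : nat.
Local Notation m := n.+3.

(** Subtraction is truncated, so the sum of the two differences is the absolute difference of [i]
    and [j]. *)
Definition cdist (i j : nat) : nat :=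
  minn ((i - j) + (j - i)) (m - ((i - j) + (j - i))).

Lemma cdist_refl (i : nat) : cdist i i = 0.
Proof. by rewrite /cdist subnn min0n. Qed.

Lemma val_Zp_add1 (i : 'Z_m) : val (i + 1)%R = if i == m.-1 :> nat then 0 else i.+1.
Proof.
rewrite /= addn1; have := ltn_ord i; rewrite /Zp_trunc /= => lti.
by case: eqP => [->|ne]; [rewrite modnn | rewrite modn_small //; lia].
Qed.

Lemma cycle_graphE (i j : 'Z_m) :
  cycle_graph m i j =
    [|| j == i.+1 :> nat, i == j.+1 :> nat, (i == m.-1 :> nat) && (j == 0 :> nat)
      | (j == m.-1 :> nat) && (i == 0 :> nat)].
Proof.
rewrite /cycle_graph -!(inj_eq val_inj) !val_Zp_add1 /=.
have := ltn_ord i; have := ltn_ord j; rewrite /Zp_trunc /=.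
move: (nat_of_ord i) (nat_of_ord j) => a b ltb lta.
by case: (a =P n.+2); case: (b =P n.+2); lia.
Qed.

(** The first step along a shorter arc towards [j] gains one; iterating it gives the geodesic of
    [cycle_walk]. *)
Lemma cdist_step (i j : nat) : i < m -> j < m -> i != j ->
  cdist i j = (cdist (if i == m.-1 then 0 else i.+1) j).+1
  \/ cdist i j = (cdist (if i == 0 then m.-1 else i.-1) j).+1.
Proof.
move=> ltim ltjm nij; rewrite /cdist.
by case: (i =P n.+2) => /= ?; case: (i =P 0) => /= ?; lia.
Qed.

Lemma cycle_walk (i j : 'Z_m) :
  exists p, [/\ path (cycle_graph m) i p, last i p = j & size p = cdist i j].
Proof.
have [d] := ubnP (cdist i j); elim: d i => // d IHd i led.
have [->|nij] := eqVneq i j; first by exists [::]; rewrite /= cdist_refl.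
suff [k ik kj] : exists2 k : 'Z_m, cycle_graph m i k & cdist i j = (cdist k j).+1.
  have [|p [kp pj szp]] := IHd k; first by rewrite -ltnS -kj.
  by exists (k :: p); split; rewrite /= ?ik ?szp.
have lti : i < m := ltn_ord i.
case: (@cdist_step i j (ltn_ord i) (ltn_ord j) nij).
- have ltk : (if i == m.-1 :> nat then 0 else i.+1) < m by case: eqP; lia.
  exists (Ordinal ltk); rewrite // cycle_graphE /=.
  by have [->|] := nat_of_ord i =P n.+2; lia.
- have ltk : (if i == 0 :> nat then m.-1 else i.-1) < m by case: eqP; lia.
  exists (Ordinal ltk); rewrite // cycle_graphE /=.
  by have [->|] := nat_of_ord i =P 0; lia.
Qed.

Lemma dist_cycle (i j : 'Z_m) : dist (cycle_graph m) i j = cdist i j.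
Proof.
have [p [ip pj szp]] := cycle_walk i j; rewrite -pj in szp *.
apply: (dist_eq (g := fun k : 'Z_m => cdist i k)) => //.
- move=> y z; rewrite cycle_graphE /cdist.
  have := ltn_ord y; have := ltn_ord z; have := ltn_ord i.
  rewrite /Zp_trunc /=; lia.
- exact: cdist_refl.
- rewrite card_ord /Zp_trunc /cdist /=; lia.
Qed.

End Cycle.

(** * Symmetric differences and sums over the two-element field *)

Lemma addvv (k : nat) (v : 'rV['F_2]_k) : (v + v = 0)%R.
Proof.
rewrite -mulr2n -scaler_nat (_ : 2%:R = 0 :> 'F_2)%R ?scale0r //.
exact: val_inj.
Qed.

Section SymDiff.
Variable I : finType.
Implicit Types A B : {set I}.

Lemma in_symdiff A B i : (i \in symdiff A B) = (i \in A) (+) (i \in B).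
Proof. by rewrite !inE; case: (i \in A); case: (i \in B). Qed.

Lemma card_symdiff A B : #|symdiff A B| + 2 * #|A :&: B| = #|A| + #|B|.
Proof.
rewrite cardsU -(cardsID B A) -(cardsID A B) [B :&: A]setIC.
rewrite (_ : _ :&: (B :\: A) = set0) ?cards0; first by lia.
by apply/setP => i; rewrite !inE; case: (i \in A); case: (i \in B).
Qed.

Lemma symdiff_eq0 A B : symdiff A B = set0 -> A = B.
Proof.
move=> /setP D0; apply/setP => i; have := D0 i; rewrite in_symdiff inE.
by case: (i \in A); case: (i \in B).
Qed.

Lemma sum_symdiff (k : nat) (s : I -> 'rV['F_2]_k) A B :
  (\sum_(i in symdiff A B) s i = \sum_(i in A) s i + \sum_(i in B) s i)%R.
Proof.
rewrite [LHS]big_mkcond [X in (X + _)%R]big_mkcond [X in (_ + X)%R]big_mkcond.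
rewrite -big_split /=.
apply: eq_bigr => i _; rewrite in_symdiff.
by case: (i \in A); case: (i \in B); rewrite /= ?addr0 ?add0r ?addvv.
Qed.

End SymDiff.

(** Adding the [s i] one at a time is a walk with [#|D|] edges; [s] may repeat values. *)
Lemma Cay_dist_sum (k : nat) (S : {set 'rV['F_2]_k}) (I : finType)
    (s : I -> 'rV['F_2]_k) (D : {set I}) (u : 'rV['F_2]_k) :
  (forall i, s i \in S) -> dist (Cay S) u (u + \sum_(i in D) s i)%R <= #|D|.
Proof.
move=> sS; rewrite -big_enum cardE.
suff [p [up <- <-]] : exists p, [/\ path (Cay S) u p,
    last u p = (u + \sum_(i <- enum D) s i)%R & size p = size (enum D)].
  exact: dist_le_path.
elim: (enum D) u => [|i r IHr] u; first by exists [::]; rewrite big_nil addr0.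
have [p [up lastp szp]] := IHr (u + s i)%R.
exists ((u + s i)%R :: p); split; rewrite /= ?szp ?lastp ?big_cons ?addrA //.
by rewrite up andbT; apply/exists_inP; exists (s i).
Qed.

(** * Ranks and intervals in ['I_m] *)

Section InitialSegments.
Variables (m : nat) (x : {set 'I_m}).

Lemma ex_rank (t : nat) : t < #|x| ->
  exists2 r : 'I_m, r \in x & #|[set i in x | i < r]| = t.
Proof.
move=> ltt; have exk : exists k, t < #|[set i in x | i < k]|.
  exists m; rewrite (_ : [set i in x | i < m] = x) //.
  by apply/setP => i; rewrite inE ltn_ord andbT.
case: (ex_minnP exk) => -[|k] ltk mink.
  move: ltk; rewrite (_ : [set i in x | i < 0] = set0) ?cards0 //.
  by apply/setP => i; rewrite !inE andbF.
have lek : #|[set i in x | i < k]| <= t.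
  by rewrite leqNgt; apply/negP => /mink; rewrite ltnn.
(* By minimality the count first exceeds [t] when [k] is added to the segment, so [k] must lie in
   [x]. *)
have [r /andP[rx /eqP rk]|nok] := pickP [pred r : 'I_m | (r \in x) && (r == k :> nat)].
  exists r => //; apply/eqP; rewrite rk eqn_leq lek /= -ltnS.
  apply: leq_trans ltk _; apply: (@leq_trans #|r |: [set i in x | i < k]|).
    apply/subset_leq_card/subsetP => i; rewrite !inE -(inj_eq val_inj) /= rk.
    by case: (i \in x) => //=; lia.
  by rewrite cardsU1 -add1n leq_add2r leq_b1.
suff : #|[set i in x | i < k.+1]| <= #|[set i in x | i < k]| by lia.
apply/subset_leq_card/subsetP => i; rewrite !inE => /andP[ix]; rewrite ix /=.
by have := nok i; rewrite /= ix /=; lia.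
Qed.

Lemma card_interval (a b : nat) : a <= b -> b <= m ->
  #|[set i : 'I_m | a <= i < b]| = b - a.
Proof.
move=> leab lebm; rewrite -sum1dep_card.
rewrite -(big_mkord (fun i => a <= i < b) (fun=> 1)).
rewrite -[RHS]muln1 -sum_nat_const_nat.
rewrite [RHS](big_nat_widenl _ 0) // [RHS](big_nat_widen _ _ m) //.
Qed.

End InitialSegments.

(** The value [b = n.+3] is allowed and stands for vertex 0, so that intervals may end at the last
    edge. *)
Lemma cdist_nat (n a b : nat) : a <= b <= n.+3 ->
  cdist n (a%:R%R : 'Z_n.+3) (b%:R%R : 'Z_n.+3) = minn (b - a) (n.+3 - (b - a)).
Proof.
move=> /andP[leab lebm]; rewrite !val_Zp_nat //.
have modm c : c <= n.+3 -> c %% n.+3 = if c == n.+3 then 0 else c.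
  by case: eqP => [->|ne lec]; rewrite ?modnn // modn_small //; lia.
rewrite !modm ?(leq_trans leab) // /cdist.
by case: (a =P n.+3); case: (b =P n.+3); lia.
Qed.

(** * Lower bound: edge labels and their relations *)

Section LowerBound.
Variables (n k : nat) (S : {set 'rV['F_2]_k}) (f : 'Z_n.+3 -> 'rV['F_2]_k).
Local Notation m := n.+3.
Hypothesis f_isom : forall i j, dist (Cay S) (f i) (f j) = dist (cycle_graph m) i j.
Local Notation F := (fun i : nat => f i%:R%R).
(** [F] reads its argument modulo [m], so the last label belongs to the edge back to vertex 0. *)
Let s (i : 'I_m) := (F i + F i.+1)%R.

Lemma label_in (i : 'I_m) : s i \in S.
Proof.
have /dist1_edge/exists_inP[v vS] : dist (Cay S) (F i) (F i.+1) = 1.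
  have lti := ltn_ord i.
  by rewrite f_isom dist_cycle cdist_nat //; lia.
by move=> /eqP Fi1; rewrite /s Fi1 addrA addvv add0r.
Qed.

Lemma sum_initial (a : nat) : a <= m ->
  (\sum_(i in [set i : 'I_m | (i < a)%N]) s i = F 0 + F a)%R.
Proof.
elim: a => [_|a IHa ltam].
  by rewrite big1 ?addvv // => i; rewrite inE ltn0.
rewrite (_ : [set i : 'I_m | i < a.+1] = Ordinal ltam |: [set i : 'I_m | i < a]).
  rewrite big_setU1 ?inE ?ltnn // IHa ?(ltnW ltam) //.
  by rewrite /s /= addrC addrA -(addrA (F 0)) addvv addr0.
by apply/setP => i; rewrite !inE -(inj_eq val_inj) /=; lia.
Qed.

Lemma sum_interval (a b : nat) : a <= b -> b <= m ->
  (\sum_(i in [set i : 'I_m | (a <= i < b)%N]) s i = F a + F b)%R.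
Proof.
move=> leab lebm.
rewrite (_ : [set i : 'I_m | a <= i < b] =
    symdiff [set i : 'I_m | i < b] [set i : 'I_m | i < a]).
  rewrite sum_symdiff !sum_initial ?(leq_trans leab) //.
  by rewrite addrACA addvv add0r addrC.
by apply/setP => i; rewrite in_symdiff !inE; lia.
Qed.

(** Only the label sum of [W] matters, not its shape, so [W] may also be the arc running the other
    way round from [a] to [b]. *)
Lemma leq_dist_kernel (W x : {set 'I_m}) (a b : nat) :
    (\sum_(i in x) s i = 0)%R -> (\sum_(i in W) s i = F a + F b)%R ->
    a <= b <= m ->
  minn (b - a) (m - (b - a)) <= #|symdiff W x|.
Proof.
move=> x0 WE leab; rewrite -cdist_nat // -dist_cycle -f_isom.
have -> : F b = (F a + \sum_(i in symdiff W x) s i)%R.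
  by rewrite sum_symdiff WE x0 addr0 addrA addvv add0r.
exact/Cay_dist_sum/label_in.
Qed.

Lemma even_kernel_trivial (x : {set 'I_m}) : odd m -> ~~ odd #|x| ->
  (\sum_(i in x) s i = 0)%R -> x = set0.
Proof.
move=> modd xeven x0; apply/eqP; apply/negPn/negP; rewrite -card_gt0 => xgt0.
pose h := #|x|./2; have xE : #|x| = 2 * h by rewrite /h; lia.
clearbody h.
(* [p] is the least element of [x] and [q] the one of rank [h], with ranks counted from 0. *)
have [p px pr] := ex_rank xgt0.
have [|q qx qr] := @ex_rank _ x h; first by lia.
have ltp := ltn_ord p; have ltq := ltn_ord q.
have minp i : i \in x -> p <= i.
  move=> ix; rewrite leqNgt; apply/negP => ltip.
  by move/eqP: pr; rewrite cards_eq0 => /eqP/setP/(_ i); rewrite !inE ix ltip.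
have ltpq : p < q.
  rewrite ltn_neqAle minp // andbT; apply/negP => /eqP epq.
  by rewrite -epq pr in qr; lia.
(* The two closed arcs between the edges [p] and [q]: [W2] is the complement of the open interval,
   so both arcs contain both ends. *)
pose W1 := [set i : 'I_m | p <= i < q.+1].
pose W2 := symdiff [set i : 'I_m | p.+1 <= i < q] setT.
have W1I : W1 :&: x = q |: [set i in x | i < q].
  apply/setP => i; rewrite inE /W1 !inE -(inj_eq val_inj) /=.
  have [ix|nix] := boolP (i \in x); first by have := minp _ ix; lia.
  by rewrite andbF orbF; apply/esym/negbTE; apply: contra nix => /eqP/val_inj->.
have W2I : W2 :&: x = p |: (x :\: [set i in x | i < q]).
  apply/setP => i; rewrite inE /W2 in_symdiff !inE -(inj_eq val_inj) /=.
  have [ix|nix] := boolP (i \in x); first by have := minp _ ix; lia.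
  by rewrite !andbF orbF; apply/esym/negbTE; apply: contra nix => /eqP/val_inj->.
have cW1I : #|W1 :&: x| = h.+1 by rewrite W1I cardsU1 !inE ltnn andbF qr.
have cW2I : #|W2 :&: x| = h.+1.
  have subx : [set i in x | i < q] \subset x.
    by apply/subsetP => i; rewrite inE => /andP[].
  by rewrite W2I cardsU1 !inE px ltpq /= cardsD (setIidPr subx) qr xE; lia.
have cW1 : #|W1| = q.+1 - p by rewrite card_interval //; lia.
have cW2 : #|W2| = m - (q - p.+1).
  have := card_symdiff [set i : 'I_m | p.+1 <= i < q] setT.
  rewrite setIT cardsT card_ord card_interval // -/W2; lia.
have dist1 := leq_dist_kernel (W := W1) (a := p) (b := q.+1) x0.
have dist2 := leq_dist_kernel (W := W2) (a := p.+1) (b := q) x0.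
have {}dist1 : minn (q.+1 - p) (m - (q.+1 - p)) <= #|symdiff W1 x|.
  by apply: dist1; [apply: sum_interval | ]; lia.
have {}dist2 : minn (q - p.+1) (m - (q - p.+1)) <= #|symdiff W2 x|.
  apply: dist2; last by lia.
  rewrite sum_symdiff sum_interval //; last by lia.
  (* The labels of the whole cycle telescope to [F 0 + F m], which is zero because [m] vanishes in
     ['Z_m]. *)
  rewrite (_ : setT = [set i : 'I_m | i < m]) ?sum_initial //; last first.
    by apply/setP => i; rewrite !inE ltn_ord.
  by rewrite pchar_Zp // addvv addr0.
(* Each symmetric difference has [|W| + 2h - 2(h+1) = |W| - 2] elements, which excludes the term of
   the minimum coming from the length of [W] itself. *)
have := card_symdiff W1 x; have := card_symdiff W2 x.
rewrite cW1 cW2 cW1I cW2I xE; lia.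
Qed.

Lemma card_even_bound : odd m -> n.+2 <= k.
Proof.
move=> modd.
pose phi (x : {set 'I_m}) := ((\sum_(i in x) s i)%R, odd #|x|).
(* Two sets with equal image differ by an even set with zero label sum. *)
have phi_inj : injective phi.
  move=> x y [sxy oxy]; apply/symdiff_eq0/even_kernel_trivial => //.
    have /(congr1 odd) := card_symdiff x y.
    by rewrite mul2n !oddD odd_double addbF oxy addbb => ->.
  by rewrite sum_symdiff sxy addvv.
have := leq_card phi phi_inj.
rewrite -[X in X <= _]cardsT -powersetT card_powerset cardsT card_ord.
rewrite card_prod card_mx card_bool card_Fp // mul1n.
by rewrite -expnSr leq_exp2l.
Qed.

End LowerBound.


(** * Upper bound: a cycle in the folded cube *)

Section UpperBound.
Variable n : nat.
Local Notation m := n.+3.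
Local Notation d := n.+2.

Definition weight (v : 'rV['F_2]_d) : nat := #|[set t | v 0%R t != 0%R]|.

(** The unit vectors give the [d]-cube; the all-ones vector adds its antipodal edges. *)
Definition folded_gens : {set 'rV['F_2]_d} :=
  const_mx 1%R |: [set delta_mx 0%R t | t : 'I_d].

Definition prefix_vec (i : nat) : 'rV['F_2]_d := (\row_(t < d) (t < i)%N%:R)%R.

Lemma F2_neq0D (a b : 'F_2) : ((a + b)%R != 0%R) = (a != 0%R) (+) (b != 0%R).
Proof. by case: a b => [[|[|a]] lta] [[|[|b]] ltb]. Qed.

Lemma F2_natb_neq0 (b : bool) : (b%:R != 0 :> 'F_2)%R = b.
Proof. by case: b. Qed.

Lemma weight_le (v : 'rV['F_2]_d) : weight v <= d.
Proof. by rewrite -[X in _ <= X]card_ord max_card. Qed.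

Lemma weightD (u v : 'rV['F_2]_d) : weight (u + v)%R =
  #|symdiff [set t | u 0%R t != 0%R] [set t | v 0%R t != 0%R]|.
Proof.
by apply: eq_card => t; rewrite in_symdiff !inE mxE F2_neq0D.
Qed.

Lemma folded_gens_neq0 : 0%R \notin folded_gens.
Proof.
rewrite !inE negb_or; apply/andP; split.
  by apply/eqP => /rowP/(_ 0%R); rewrite !mxE.
by apply/imsetP => -[t _ /rowP/(_ t)]; rewrite !mxE !eqxx.
Qed.

Lemma folded_gens_gen : <<folded_gens>>%g = [set: 'rV['F_2]_d].
Proof.
apply/eqP; rewrite eqEsubset subsetT /=; apply/subsetP => v _.
rewrite [v]row_sum_delta.
apply: (big_ind (fun u => u \in <<folded_gens>>%g)) => [||t _]; first exact: group1.
  by move=> u w; apply: groupM.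
have [->|] := eqVneq (v 0%R t) 0%R; first by rewrite scale0r; apply: group1.
case: (v 0%R t) => [[|[|a]] lta] // _.
rewrite (_ : Ordinal lta = 1%R) ?scale1r; last exact: val_inj.
by apply/mem_gen/setU1r/imset_f.
Qed.

Lemma prefix_vecS (i : 'I_d) :
  prefix_vec i.+1 = (prefix_vec i + delta_mx 0%R i)%R.
Proof.
apply/rowP => t; rewrite !mxE eqxx /= -(inj_eq val_inj) /= ltnS leq_eqVlt.
by case: ltngtP => _; rewrite ?addr0 ?add0r.
Qed.

Lemma prefix_vec_edge (i j : 'Z_m) : cycle_graph m i j ->
  Cay folded_gens (prefix_vec i) (prefix_vec j).
Proof.
have CayD u w : w \in folded_gens ->
    Cay folded_gens u (u + w)%R && Cay folded_gens (u + w)%R u.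
  move=> wS; apply/andP; split; apply/exists_inP; exists w => //.
  by rewrite -addrA addvv addr0.
have CayS k : k < d -> Cay folded_gens (prefix_vec k) (prefix_vec k.+1)
    && Cay folded_gens (prefix_vec k.+1) (prefix_vec k).
  by move=> ltk; rewrite (prefix_vecS (Ordinal ltk)) CayD // setU1r // imset_f.
(* The all-ones generator closes the cycle. *)
have Cay0 : Cay folded_gens (prefix_vec 0) (prefix_vec d)
    && Cay folded_gens (prefix_vec d) (prefix_vec 0).
  rewrite (_ : prefix_vec d = (prefix_vec 0 + const_mx 1)%R) ?CayD ?setU11 //.
  by apply/rowP => t; rewrite !mxE ltn_ord add0r.
rewrite cycle_graphE => /or4P[/eqP ji|/eqP ij|/andP[/eqP-> /eqP->]|/andP[/eqP-> /eqP->]].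
- by rewrite ji; have /CayS/andP[] : i < d by rewrite -ltnS -ji ltn_ord.
- by rewrite ij; have /CayS/andP[] : j < d by rewrite -ltnS -ij ltn_ord.
- by case/andP: Cay0.
- by case/andP: Cay0.
Qed.

Lemma weight_prefix (i j : nat) : i <= d -> j <= d ->
  weight (prefix_vec i + prefix_vec j)%R = (i - j) + (j - i).
Proof.
wlog leij : i j / i <= j => [wl|_ lejd].
  have [/wl//|/ltnW leji] := leqP i j.
  by move=> lei lej; rewrite addrC wl // addnC.
rewrite (eqP leij) add0n -(@card_interval d) //; apply: eq_card => t.
rewrite !inE !mxE F2_neq0D !F2_natb_neq0.
by have [lti|_] := ltnP t i; [rewrite (leq_trans lti leij) | case: (t < j)].
Qed.

(** A unit vector changes the weight by one. The all-ones vector replaces a weight [c] by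
    [m - 1 - c], which swaps the two terms of the minimum up to one. *)
Lemma weight_lipschitz (x u v : 'rV['F_2]_d) : Cay folded_gens u v ->
  minn (weight (x + v)%R) (m - weight (x + v)%R) <=
  (minn (weight (x + u)%R) (m - weight (x + u)%R)).+1.
Proof.
case/exists_inP => w wS /eqP->; rewrite (_ : x + (u + w) = x + u + w)%R ?addrA //.
have := card_symdiff [set t | (x + u)%R 0%R t != 0%R] [set t | w 0%R t != 0%R].
rewrite -weightD -/(weight (x + u)%R) -/(weight w); set c := #|_ :&: _| => cE.
have cle : c <= weight (x + u)%R by apply/subset_leq_card/subsetIl.
have clew : c <= weight w by apply/subset_leq_card/subsetIr.
have ule := weight_le (x + u)%R.
case/setU1P: wS => [wE | /imsetP[t _ wE]].
  have w1 : weight w = d.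
    by rewrite -[RHS]card_ord; apply: eq_card => t; rewrite wE !inE mxE.
  have : c = weight (x + u)%R.
    by rewrite /c wE (setIidPl _) //; apply/subsetP => t _; rewrite inE mxE.
  lia.
have w1 : weight w = 1.
  rewrite -(cards1 t); apply: eq_card => r; rewrite wE !inE mxE eqxx /=.
  by case: (r == t).
lia.
Qed.

Lemma dist_folded (i j : 'Z_m) :
  dist (Cay folded_gens) (prefix_vec i) (prefix_vec j) = dist (cycle_graph m) i j.
Proof.
rewrite dist_cycle; have [p [ip pj szp]] := cycle_walk i j.
pose g (v : 'rV['F_2]_d) :=
  minn (weight (prefix_vec i + v)%R) (m - weight (prefix_vec i + v)%R).
have gE (k : 'Z_m) : g (prefix_vec k) = cdist n i k.
  by rewrite /g weight_prefix // -ltnS ltn_ord.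
pose q := [seq prefix_vec (k : 'Z_m) | k <- p].
have lastq : last (prefix_vec i) q = prefix_vec j.
  by rewrite (last_map (fun k : 'Z_m => prefix_vec k)) pj.
rewrite -lastq (dist_eq (g := g)) ?lastq ?gE //.
- by move=> u v; apply: weight_lipschitz.
- exact: cdist_refl.
- rewrite (path_map (f := fun k : 'Z_m => prefix_vec k)).
  by apply: sub_path ip => u v; apply: prefix_vec_edge.
- by rewrite size_map.
(* The cube has [2 ^ d > d] vertices, enough to keep the distance within the search range. *)
- rewrite card_mx card_Fp // mul1n; apply: leq_trans (ltn_expl d (ltnSn 1)).
  rewrite /cdist; have := ltn_ord i; have := ltn_ord j; rewrite /Zp_trunc /=; lia.
Qed.

End UpperBound.

Theorem theorem2p40 (m : nat) (modd : odd m) (mge3 : 3 <= m)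
    (hm : m <= 17 \/ cyclic_interval_property m) :
  is_kmin (cycle_graph m) (m - 1).
Proof.
case: m modd mge3 hm => [|[|[|n]]] // modd _ _; rewrite subn1 /=; split.
  exists (folded_gens n); split; [exact: folded_gens_neq0 | exact: folded_gens_gen |].
  by exists (fun i : 'Z_n.+3 => prefix_vec n i) => i j; apply: dist_folded.
by move=> k [S [_ _ [f f_isom]]]; apply: card_even_bound f_isom modd.
Qed.
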